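(* Let $E$ be a vector space over $\mathbb K$ ($\mathbb R$ or $\mathbb C$), let $(\mathbf S_n)_{n\ge 0}$ be a sequence in $E$, let $\mathbf y\in E^*$, and let $\boldsymbol{\widetilde\varepsilon}_{2k}^{(n)}=\mathbf{\widetilde e}_k(\mathbf S_n)\in E$ denote the second topological Shanks transforms of $(\mathbf S_n)$. Let $\varepsilon_k^{(n)}$ be the scalars obtained by applying the scalar $\varepsilon$-algorithm to the sequence of numbers $S_n=\langle \mathbf y,\mathbf S_n\rangle$. Then $\boldsymbol{\widetilde\varepsilon}_0^{(n)}=\mathbf S_n$ for all $n\ge 0$, and for all $k,n=0,1,\ldots$ the following (equivalent) relations hold: $$\boldsymbol{\widetilde\varepsilon}_{2k+2}^{(n)}=\boldsymbol{\widetilde\varepsilon}_{2k}^{(n+1)}+\frac{1}{(\varepsilon_{2k}^{(n+2)}-\varepsilon_{2k}^{(n+1)})(\varepsilon_{2k+1}^{(n+1)}-\varepsilon_{2k+1}^{(n)})}\,(\boldsymbol{\widetilde\varepsilon}_{2k}^{(n+2)}-\boldsymbol{\widetilde\varepsilon}_{2k}^{(n+1)}),$$ $$\boldsymbol{\widetilde\varepsilon}_{2k+2}^{(n)}=\boldsymbol{\widetilde\varepsilon}_{2k}^{(n+1)}+\frac{\varepsilon_{2k+1}^{(n+1)}-\varepsilon_{2k-1}^{(n+2)}}{\varepsilon_{2k+1}^{(n+1)}-\varepsilon_{2k+1}^{(n)}}\,(\boldsymbol{\widetilde\varepsilon}_{2k}^{(n+2)}-\boldsymbol{\widetilde\varepsilon}_{2k}^{(n+1)}),$$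 $$\boldsymbol{\widetilde\varepsilon}_{2k+2}^{(n)}=\boldsymbol{\widetilde\varepsilon}_{2k}^{(n+1)}+\frac{\varepsilon_{2k+2}^{(n)}-\varepsilon_{2k}^{(n+1)}}{\varepsilon_{2k}^{(n+2)}-\varepsilon_{2k}^{(n+1)}}\,(\boldsymbol{\widetilde\varepsilon}_{2k}^{(n+2)}-\boldsymbol{\widetilde\varepsilon}_{2k}^{(n+1)}),$$ $$\boldsymbol{\widetilde\varepsilon}_{2k+2}^{(n)}=\boldsymbol{\widetilde\varepsilon}_{2k}^{(n+1)}+(\varepsilon_{2k+1}^{(n+1)}-\varepsilon_{2k-1}^{(n+2)})(\varepsilon_{2k+2}^{(n)}-\varepsilon_{2k}^{(n+1)})\,(\boldsymbol{\widetilde\varepsilon}_{2k}^{(n+2)}-\boldsymbol{\widetilde\varepsilon}_{2k}^{(n+1)}).$$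
   Context: $E^*$ is the algebraic dual of $E$ and $\langle\cdot,\cdot\rangle$ the duality product. $\Delta$ is the forward difference operator, $\Delta \mathbf S_n=\mathbf S_{n+1}-\mathbf S_n$. Second topological Shanks transformation: for $k,n\ge 0$, let $a_0^{(n,k)},\ldots,a_k^{(n,k)}\in\mathbb K$ be the solution of the linear system $\sum_{i=0}^k a_i^{(n,k)}=1$ and $\sum_{i=0}^k a_i^{(n,k)}\langle\mathbf y,\Delta\mathbf S_{n+j+i}\rangle=0$ for $j=0,\ldots,k-1$. Then $\mathbf{\widetilde e}_k(\mathbf S_n)=a_0^{(n,k)}\mathbf S_{n+k}+\cdots+a_k^{(n,k)}\mathbf S_{n+2k}$. Scalar $\varepsilon$-algorithm applied to a sequence of numbers $(S_n)$: $\varepsilon_{-1}^{(n)}=0$, $\varepsilon_0^{(n)}=S_n$, $\varepsilon_{k+1}^{(n)}=\varepsilon_{k-1}^{(n+1)}+(\varepsilon_k^{(n+1)}-\varepsilon_k^{(n)})^{-1}$ for $k,n=0,1,\ldots$. Convention: all quantities involved are assumed to be defined (the linear systems are uniquely solvable and the denominators are nonzero). *)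

(* Defs.v *)
From mathcomp Require Import all_boot all_order all_algebra.
From mathcomp Require Import complex.
From mathcomp Require Import boolp classical_sets reals.

Set Implicit Arguments.
Unset Strict Implicit.
Unset Printing Implicit Defensive.

Import GRing.Theory.
Local Open Scope ring_scope.
Local Open Scope complex_scope.

Variant scalars := RealScalars | ComplexScalars.

Definition scalar_field (R : realType) (s : scalars) : fieldType :=
  match s with
  | RealScalars => R
  | ComplexScalars => R[i]
  end.

Section ScalarEpsilon.
Context {K : fieldType}.
Implicit Type S : nat -> K.

(* The lower index is shifted by one: [eps_shift S j n] is
   $\varepsilon_{j-1}^{(n)}$, so that $j = 0$ is the column of zeros. *)
Fixpoint eps_shift S (j n : nat) {struct j} : K :=
  match j with
  | 0 => 0
  | j1.+1 =>
    match j1 with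
    | 0 => S n
    | j2.+1 =>
        eps_shift S j2 n.+1 + (eps_shift S j1 n.+1 - eps_shift S j1 n)^-1
    end
  end.

(* No inverse of 0 is taken in the computation of [eps_shift S j n] (inversion
   being total, with $0^{-1} = 0$, this has to be required separately). *)
Fixpoint eps_shift_defined S (j n : nat) {struct j} : Prop :=
  match j with
  | 0 => True
  | j1.+1 =>
    match j1 with
    | 0 => True
    | j2.+1 =>
        [/\ eps_shift_defined S j2 n.+1, eps_shift_defined S j1 n.+1,
            eps_shift_defined S j1 n
          & eps_shift S j1 n.+1 - eps_shift S j1 n != 0]
    end
  end.

(* $\varepsilon_k^{(n)}$; only $k \ge -1$ is meaningful, and every negative [k]
   is given the value 0 of the column $k = -1$. *)
Definition eps S (k : int) (n : nat) : K :=
  match k with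
  | Posz k' => eps_shift S k'.+1 n
  | Negz _ => 0
  end.

Definition eps_defined S (k : int) (n : nat) : Prop :=
  match k with
  | Posz k' => eps_shift_defined S k'.+1 n
  | Negz _ => True
  end.

Lemma eps_m1 S n : eps S (-1) n = 0.
Proof. by []. Qed.

Lemma eps_0 S n : eps S 0 n = S n.
Proof. by []. Qed.

Lemma eps_rec S (k n : nat) :
  eps S (k%:Z + 1) n =
  eps S (k%:Z - 1) n.+1 + (eps S k%:Z n.+1 - eps S k%:Z n)^-1.
Proof.
case: k => [|k] //; rewrite -PoszD addn1.
by have -> : k.+1%:Z - 1 = k by rewrite -addn1 PoszD addrK.
Qed.

Lemma eps_defined_rec S (k n : nat) :
  eps_defined S (k%:Z + 1) n <->
  [/\ eps_defined S (k%:Z - 1) n.+1, eps_defined S k%:Z n.+1,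
      eps_defined S k%:Z n & eps S k%:Z n.+1 - eps S k%:Z n != 0].
Proof.
case: k => [|k] //; rewrite -PoszD addn1.
by have -> : k.+1%:Z - 1 = k by rewrite -addn1 PoszD addrK.
Qed.

End ScalarEpsilon.

Section TopologicalShanks.
Context {K : fieldType} {E : lmodType K}.
Context (y : {scalar E}) (S : nat -> E).

Definition shanks_system (k n : nat) (a : {ffun 'I_k.+1 -> K}) : Prop :=
  \sum_(i < k.+1) a i = 1 /\
  forall j : 'I_k,
    \sum_(i < k.+1) a i * y (S (n + j + i).+1 - S (n + j + i)%N) = 0.

Definition shanks_solvable (k n : nat) : Prop :=
  exists! a : {ffun 'I_k.+1 -> K}, shanks_system n a.

(* "The" solution: some solution if there is one, and 0 otherwise. *)
Definition shanks_coef (k n : nat) : {ffun 'I_k.+1 -> K} :=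
  xget 0 [set a | shanks_system n a]%classic.

(* $\widetilde{\mathbf e}_k(\mathbf S_n)$, that is
   $\widetilde{\boldsymbol\varepsilon}_{2k}^{(n)}$. *)
Definition shanks2 (k n : nat) : E :=
  \sum_(i < k.+1) shanks_coef k n i *: S (n + k + i)%N.

End TopologicalShanks.

(* Main.v *)
From HB Require Import structures.
Require Import Defs.
From mathcomp Require Import all_boot all_order all_algebra.
From mathcomp Require Import reals.
From mathcomp Require Import classical_sets ring zify.

Set Implicit Arguments.
Unset Strict Implicit.
Unset Printing Implicit Defensive.

Import GRing.Theory.
Local Open Scope ring_scope.

(** A coefficient vector is encoded as a polynomial [p], and [mom n p] is the
    image of [p] under the linear map sending [X^i] to [S (n + i)]; multiplying
    by [X] shifts [n], so multiplying by [X - 1] is taking differences.  With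
    [L n p] the duality product of [y] and [mom n p], the scalar quantities are
    characterised by

    - $\varepsilon_{2k}^{(n)} = v$: some [a] of degree at most [k] has
      [a(1) = 1] and [L (n + j) a = v] for [j <= k];
    - $\varepsilon_{2k-1}^{(n)} = w$: some [b] of degree less than [k] has
      [b(1) = w] and [L (n + j) ((X - 1) b) = 1] for [j < k].

    The polynomials need not be unique, but [v] and [w] are: two solutions are
    compared by evaluating [L n] on their product in two ways.  If [a], [a']
    belong to [n], [n + 1], then [(X a' - a) / ((X - 1) (v' - v))] is a solution
    for the next odd column; if [b], [b'] do, then [(X b' - b) / (w' - w)] is
    one for the next even column.  Uniqueness of the values turns this into the
    epsilon-algorithm.

    For the vectors, the solution of order [k + 1] at [n] lies on the affine
    line through [a1] and [X a2], where [a1], [a2] are the solutions of order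
    [k] at [n + 1], [n + 2]; applying [y] determines its position on that line. *)

(** * Polynomials as coefficient vectors over a sequence *)

Section Moments.
Context {K : fieldType} {E : lmodType K} (S : nat -> E).
Implicit Types p q : {poly K}.

Definition mom n p : E := \sum_(i < size p) p`_i *: S (n + i)%N.

Lemma mom_widen N n p : (size p <= N)%N ->
  mom n p = \sum_(i < N) p`_i *: S (n + i)%N.
Proof.
move=> le_pN; rewrite /mom (big_ord_widen N (fun i => p`_i *: S (n + i)%N)) //.
rewrite big_mkcond; apply: eq_bigr => i _; case: ltnP => // le_pi.
by rewrite nth_default // scale0r.
Qed.

Fact mom_is_linear n : linear (mom n).
Proof.
move=> c p q; pose N := maxn (size (c *: p + q)) (maxn (size p) (size q)).
rewrite !(@mom_widen N) ?leq_max ?leqnn ?orbT // scaler_sumr -big_split /=.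
by apply: eq_bigr => i _; rewrite coefD coefZ scalerDl scalerA.
Qed.

HB.instance Definition _ n :=
  GRing.isLinear.Build K {poly K} E *:%R (mom n) (mom_is_linear n).

Lemma mom1 n : mom n 1 = S n.
Proof.
by rewrite (@mom_widen 1) ?size_poly1 // big_ord1 coef1 scale1r addn0.
Qed.

Lemma momXM n p : mom n ('X * p) = mom n.+1 p.
Proof.
rewrite (@mom_widen (size p).+1) ?(leq_trans (size_polyMleq _ _)) ?size_polyX //.
rewrite big_ord_recl coefXM scale0r add0r /mom.
by apply: eq_bigr => i _; rewrite coefXM addnS addSn.
Qed.

Lemma momXnM n i p : mom n ('X^i * p) = mom (n + i) p.
Proof.
elim: i n => [|i IHi] n; first by rewrite mul1r addn0.
by rewrite exprS -mulrA momXM IHi addSnnS.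
Qed.

Lemma mom_mul n q p :
  mom n (q * p) = \sum_(i < size q) q`_i *: mom (n + i) p.
Proof.
rewrite -{1}[q]coefK poly_def mulr_suml linear_sum /=.
by apply: eq_bigr => i _; rewrite -scalerAl linearZ /= momXnM.
Qed.

Lemma mom_diff n p : mom n (('X - 1) * p) = mom n.+1 p - mom n p.
Proof. by rewrite mulrBl mul1r linearB /= momXM. Qed.

End Moments.

(** * The columns of the scalar epsilon-algorithm *)

Section EpsilonColumns.
Context {K : fieldType} {E : lmodType K} (y : {scalar E}) (S : nat -> E).
Implicit Types p q a b : {poly K}.

Local Notation L n p := (y (mom S n p)).

(** Each [X^i] only shifts the index, and [p] keeps the value [v] at these shifts; so [q] acts
    through the sum of its coefficients. *)
Lemma L_mul_const k n q p v : (size q <= k)%N ->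
  (forall j, (j < k)%N -> L (n + j) p = v) -> L n (q * p) = q.[1] * v.
Proof.
move=> le_qk Lp; rewrite mom_mul linear_sum horner_coef mulr_suml /=.
apply: eq_bigr => i _; rewrite linearZ /= expr1n mulr1 Lp //.
exact: leq_trans le_qk.
Qed.

Definition even_sol k n v a :=
  [/\ (size a <= k.+1)%N, a.[1] = 1
    & forall j, (j <= k)%N -> L (n + j) a = v].

Definition odd_sol k n w b :=
  [/\ (size b <= k)%N, b.[1] = w
    & forall j, (j < k)%N -> L (n + j) (('X - 1) * b) = 1].

Lemma even_sol_val k n v1 v2 a1 a2 :
  even_sol k n v1 a1 -> even_sol k n v2 a2 -> v1 = v2.
Proof.
move=> [sz1 one1 L1] [sz2 one2 L2].
rewrite -[LHS]mul1r -one2 -(L_mul_const sz2 L1).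
by rewrite mulrC (L_mul_const sz1 L2) one1 mul1r.
Qed.

(** Both values equal [L n] of [('X - 1) * b1 * b2]. *)
Lemma odd_sol_val k n w1 w2 b1 b2 :
  odd_sol k n w1 b1 -> odd_sol k n w2 b2 -> w1 = w2.
Proof.
move=> [sz1 <- L1] [sz2 <- L2].
rewrite -[LHS]mulr1 -(L_mul_const sz1 L2).
by rewrite mulrCA [b1 * _]mulrC mulrCA (L_mul_const sz2 L1) mulr1.
Qed.

Lemma factor_X_sub_1 k p : p.[1] = 0 -> (size p <= k.+1)%N ->
  exists2 c, p = ('X - 1) * c & (size c <= k)%N.
Proof.
move=> p1; have /factor_theorem[c ->] : root p 1 by apply/rootP.
rewrite polyC1 mulrC => szp; exists c => //.
move: szp; have [->|c0] := eqVneq c 0.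
  by rewrite size_poly0.
by rewrite mulrC size_Mmonic -?polyC1 ?monicXsubC // size_XsubC addn2.
Qed.

Lemma odd_step k n v v' w a a' b :
  even_sol k n v a -> even_sol k n.+1 v' a' -> odd_sol k n.+1 w b ->
  v' - v != 0 -> exists b', odd_sol k.+1 n (w + (v' - v)^-1) b'.
Proof.
move=> [sza a1 La] [sza' a'1 La'] solb dv.
have [|//|c Dc szc] := @factor_X_sub_1 k (a' - a).
- by rewrite hornerD hornerN a1 a'1 subrr.
- by rewrite (leq_trans (size_polyD _ _)) // size_polyN geq_max sza'.
(* Since [a' - a] has the constant value [v' - v], its rescaled quotient solves the odd system at
   [n.+1]; uniqueness then identifies [w]. *)
have solc : odd_sol k n.+1 ((v' - v)^-1 * c.[1]) ((v' - v)^-1 *: c).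
  split; first exact: leq_trans (size_scale_leq _ _) szc.
    by rewrite hornerZ.
  move=> j lt_jk; rewrite -scalerAr -Dc !linearZ !linearB /=.
  by rewrite La' ?(ltnW lt_jk) // addSnnS La // mulVf.
rewrite (odd_sol_val solb solc).
(* This is ['X * a' - a] divided by [('X - 1) * (v' - v)], with the division carried out through
   [c]. *)
exists ((v' - v)^-1 *: ('X * c + a)); split.
- rewrite (leq_trans (size_scale_leq _ _)) // (leq_trans (size_polyD _ _)) //.
  rewrite geq_max sza andbT (leq_trans (size_polyMleq _ _)) // size_polyX /=.
  by rewrite ltnS.
- by rewrite !hornerE a1; ring.
move=> j lt_jk; rewrite -scalerAr.
have -> : ('X - 1) * ('X * c + a) = 'X * a' - a.
  by rewrite mulrDr mulrCA -Dc; ring.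
by rewrite !linearZ !linearB /= momXM -addSn La' // La // mulVf.
Qed.

Lemma even_step k n v w w' a b b' :
  even_sol k n.+1 v a -> odd_sol k.+1 n w b -> odd_sol k.+1 n.+1 w' b' ->
  w' - w != 0 -> exists a', even_sol k.+1 n (v + (w' - w)^-1) a'.
Proof.
move=> sola [szb b1 Lb] [szb' b'1 Lb'] dw.
set d := (w' - w)^-1.
(* At the shifts common to [b] and [b'] the differences cancel, so [b' - b] has constant moments; by
   uniqueness the rescaled constant is [v]. *)
have sol_diff : even_sol k n.+1 (L n.+1 (d *: (b' - b))) (d *: (b' - b)).
  split.
  - rewrite (leq_trans (size_scale_leq _ _)) // (leq_trans (size_polyD _ _)) //.
    by rewrite size_polyN geq_max szb'.
  - by rewrite !hornerE b1 b'1 mulVf.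
  elim=> [|j IHj] lt_jk; first by rewrite addn0.
  rewrite -IHj ?(ltnW lt_jk) // addnS; apply/eqP.
  rewrite -subr_eq0 -!linearB /= -mom_diff -scalerAr mulrBr !linearZ !linearB /=.
  by rewrite (Lb' _ (ltnW lt_jk)) addSnnS Lb // subrr mulr0.
have Ldiff := even_sol_val sola sol_diff.
have {}Ldiff j : (j <= k)%N -> L (n.+1 + j) (d *: (b' - b)) = v.
  by case: sol_diff => _ _ Ld /Ld ->.
have Xb : 'X * b' - b = ('X - 1) * b' + (b' - b) by ring.
exists (d *: ('X * b' - b)).
have sz : (size (d *: ('X * b' - b))%R <= k.+2)%N.
  rewrite (leq_trans (size_scale_leq _ _)) // (leq_trans (size_polyD _ _)) //.
  rewrite size_polyN geq_max (leq_trans szb) // andbT.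
  by rewrite (leq_trans (size_polyMleq _ _)) // size_polyX.
have const j : (j < k.+1)%N ->
    L (n + j).+1 (d *: ('X * b' - b)) = L (n + j) (d *: ('X * b' - b)).
  move=> lt_jk; apply/eqP; rewrite -subr_eq0 -linearB /= -mom_diff -scalerAr.
  rewrite mulrBr mulrCA !linearZ !linearB /= momXM -addSn.
  by rewrite Lb' // Lb // subrr mulr0.
(* The value is read at [n.+1], where the equations of [b'] begin; [const] carries it to the other
   shifts. *)
have val0 : L n.+1 (d *: ('X * b' - b)) = v + d.
  have := Ldiff 0 isT; have := Lb' 0 isT; rewrite addn0 => Lb'0 Ldiff0.
  have LD p q : L n.+1 (p + q) = L n.+1 p + L n.+1 q by rewrite !linearD.
  by rewrite Xb scalerDr LD Ldiff0 !linearZ /= Lb'0 mulr1 addrC.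
split=> //; first by rewrite !hornerE b1 b'1 mulVf.
elim=> [|j IHj] lt_jk; last by rewrite addnS const // IHj // ltnW.
by rewrite -val0 -[n in n.+1]addn0 const // addn0.
Qed.

Local Notation s := (fun m => y (S m)).

(** Because of the index shift, [k.*2] is column $2k-1$ and [k.*2.+1] is column $2k$. The induction
    carries both, as each step needs the two previous columns. *)
Lemma eps_shift_sol k :
  (forall n, eps_shift_defined s k.*2 n ->
     exists b, odd_sol k n (eps_shift s k.*2 n) b) /\
  (forall n, eps_shift_defined s k.*2.+1 n ->
     exists a, even_sol k n (eps_shift s k.*2.+1 n) a).
Proof.
elim: k => [|k [IHodd IHeven]].
  split=> n _; first by exists 0; split; rewrite ?size_poly0 ?horner0.
  exists 1; split; rewrite ?size_poly1 ?hornerC //.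
  by case=> // _; rewrite mom1 addn0.
have odd_col n : eps_shift_defined s k.+1.*2 n ->
    exists b, odd_sol k.+1 n (eps_shift s k.+1.*2 n) b.
  rewrite doubleS => -[/IHodd[b solb] /IHeven[a' sola'] /IHeven[a sola] dv].
  exact: odd_step sola sola' solb dv.
split=> // n [/IHeven[a sola] /odd_col[b' solb'] /odd_col[b solb] dw].
exact: even_step sola solb solb' dw.
Qed.

End EpsilonColumns.

(** * Shanks transforms as polynomials, and their recursion *)

Section ShanksPolynomials.
Context {K : fieldType} {E : lmodType K} (y : {scalar E}) (S : nat -> E).
Implicit Types p q : {poly K}.

Local Notation L n p := (y (mom S n p)).
Local Notation s := (fun m => y (S m)).

(** The equations start at shift [n], whereas the second transform itself is the moment at
    [n + k]. *)
Definition shanks_poly k n p :=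
  [/\ (size p <= k.+1)%N, p.[1] = 1
    & forall j, (j < k)%N -> L (n + j) (('X - 1) * p) = 0].

Lemma shanks_poly_system k n (a : {ffun 'I_k.+1 -> K}) p :
  (size p <= k.+1)%N -> (forall i : 'I_k.+1, p`_i = a i) ->
  shanks_poly k n p <-> shanks_system y S n a.
Proof.
move=> szp pa.
have sum_a : p.[1] = \sum_(i < k.+1) a i.
  rewrite (horner_coef_wide _ szp).
  by apply: eq_bigr => i _; rewrite expr1n mulr1.
have eqn j : L (n + j) (('X - 1) * p) =
    \sum_(i < k.+1) a i * y (S (n + j + i).+1 - S (n + j + i)%N).
  rewrite mom_diff !(mom_widen _ _ szp) -sumrB linear_sum /=.
  by apply: eq_bigr => i _; rewrite addSn -scalerBr linearZ /= pa.
split=> [[_ p1 Lp]|[a1 La]].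
  by split=> [|j]; rewrite -?sum_a // -eqn Lp.
by split=> // [|j lt_jk]; rewrite ?sum_a // eqn (La (Ordinal lt_jk)).
Qed.

Lemma shanks2_poly k n :
  (exists a : {ffun 'I_k.+1 -> K}, shanks_system y S n a) ->
  exists2 p, shanks_poly k n p & shanks2 y S k n = mom S (n + k) p.
Proof.
case=> a0 sys_a0; set a := shanks_coef y S k n.
have sys_a : shanks_system y S n a by apply: (xgetPex 0 (ex_intro _ a0 sys_a0)).
pose p := \poly_(i < k.+1) a (inord i).
have pa (i : 'I_k.+1) : p`_i = a i by rewrite coef_poly ltn_ord inord_val.
have szp : (size p <= k.+1)%N by apply: size_poly.
exists p; first exact/(shanks_poly_system _ szp pa).
by rewrite (mom_widen _ _ szp); apply: eq_bigr => i _; rewrite pa.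
Qed.

Lemma shanks_poly_uniq k n p q : shanks_solvable y S k n ->
  shanks_poly k n p -> shanks_poly k n q -> p = q.
Proof.
move=> [a [_ uniq_a]] solp solq.
have coef_a r : shanks_poly k n r -> a = [ffun i : 'I_k.+1 => r`_i].
  move=> solr; apply/uniq_a/(@shanks_poly_system _ _ _ r) => //.
    by case: solr.
  by move=> i; rewrite ffunE.
apply/polyP => i; have [lt_ik|le_ki] := ltnP i k.+1.
  have := coef_a _ solp; rewrite (coef_a _ solq).
  by move=> /ffunP/(_ (Ordinal lt_ik)); rewrite !ffunE.
have [[szp _ _] [szq _ _]] := (solp, solq).
by rewrite !nth_default // (leq_trans _ le_ki).
Qed.

Lemma shanks_poly_even_sol k n p :
  shanks_poly k n p -> even_sol y S k n (L n p) p.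
Proof.
case=> szp p1 Lp; split=> //; elim=> [|j IHj] lt_jk; first by rewrite addn0.
rewrite -IHj ?(ltnW lt_jk) // addnS; apply/eqP.
by rewrite -subr_eq0 -linearB /= -mom_diff Lp.
Qed.

(** For [j = k] this says that [y] maps the transform to $\varepsilon_{2k}^{(n)}$. *)
Lemma shanks_poly_eps k n p j : (j <= k)%N -> shanks_poly k n p ->
  eps_shift_defined s k.*2.+1 n -> L (n + j) p = eps_shift s k.*2.+1 n.
Proof.
move=> le_jk /shanks_poly_even_sol solp.
have [_ even_col] := eps_shift_sol y S k.
move=> /even_col[a sola]; rewrite -(even_sol_val solp sola).
by case: solp => _ _ ->.
Qed.

Lemma shanks2_0 n : shanks2 y S 0 n = S n.
Proof.
have [|p [szp p1 _] ->] := @shanks2_poly 0 n.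
  by exists [ffun=> 1]; split=> [|[]//]; rewrite big_ord1 ffunE.
move: p1; rewrite [p]size1_polyC // hornerC => ->.
by rewrite mom1 addn0.
Qed.

Lemma shanks2_rec k n :
  shanks_solvable y S k.+1 n -> shanks_solvable y S k n.+1 ->
  shanks_solvable y S k n.+2 -> eps_shift_defined s k.+1.*2.+1 n ->
  eps_shift_defined s k.*2.+1 n.+1 -> eps_shift_defined s k.*2.+1 n.+2 ->
  eps_shift s k.*2.+1 n.+2 - eps_shift s k.*2.+1 n.+1 != 0 ->
  shanks2 y S k.+1 n = shanks2 y S k n.+1 +
    ((eps_shift s k.+1.*2.+1 n - eps_shift s k.*2.+1 n.+1) /
     (eps_shift s k.*2.+1 n.+2 - eps_shift s k.*2.+1 n.+1))
    *: (shanks2 y S k n.+2 - shanks2 y S k n.+1).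
Proof.
move=> solv [a1 [sys1 _]] [a2 [sys2 _]] def def1 def2.
have [|p solp ->] := @shanks2_poly k.+1 n.
  by case: solv => a [sysa _]; exists a.
have [|p1 solp1 ->] := @shanks2_poly k n.+1; first by exists a1.
have [|p2 solp2 ->] := @shanks2_poly k n.+2; first by exists a2.
set e := eps_shift s _ n.
set e2 := eps_shift s _ n.+2; set e1 := eps_shift s _ _.
move=> de.
(* The direction of the affine line: every [p1 + t *: r] satisfies the normalization and all
   equations of order [k.+1] except the one for [j = 0]. *)
pose r := 'X * p2 - p1.
have [szp onep Lp] := solp.
have [sz1 one1 L1] := solp1; have [sz2 one2 L2] := solp2.
have szr : (size r <= k.+2)%N.
  rewrite (leq_trans (size_polyD _ _)) // size_polyN geq_max (leq_trans sz1) //.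
  by rewrite (leq_trans (size_polyMleq _ _)) // size_polyX.
have r1 : r.[1] = 0 by rewrite !hornerE one1 one2 subrr.
have Lr j : (j < k)%N -> L (n + j.+1) (('X - 1) * r) = 0.
  move=> lt_jk; rewrite mulrBr mulrCA !linearB /= momXM -addSnnS.
  by rewrite -addSn L1 // L2 // subrr.
have momr m : mom S m r = mom S m.+1 p2 - mom S m p1.
  by rewrite linearB /= momXM.
have Lr_const : L (n + k.+1) r = e2 - e1.
  rewrite momr linearB /= -addSnnS -addSn.
  by rewrite (shanks_poly_eps _ solp1) // (shanks_poly_eps _ solp2).
(* Otherwise [p + r] would be a second solution of order [k + 1]. *)
have Lr0 : L n (('X - 1) * r) != 0.
  apply: contraNneq de => Lr0.
  rewrite -Lr_const; have -> : r = 0.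
    have solpr : shanks_poly k.+1 n (p + r).
      split.
      - by rewrite (leq_trans (size_polyD _ _)) // geq_max szp.
      - by rewrite hornerD onep r1 addr0.
      move=> j lt_jk; rewrite mulrDr !linearD /= Lp // add0r.
      by case: j lt_jk => [|j] lt_jk; rewrite ?addn0 // Lr.
    by apply: (addrI p); rewrite addr0 -(shanks_poly_uniq solv solp solpr).
  by rewrite !linear0.
(* The parameter that solves the remaining equation, [j = 0]. *)
clearbody r; pose t := - L n (('X - 1) * p1) / L n (('X - 1) * r).
have Dp : p = p1 + t *: r.
  apply: (shanks_poly_uniq solv solp); split.
  - rewrite (leq_trans (size_polyD _ _)) // geq_max (leq_trans sz1) //.
    exact: leq_trans (size_scale_leq _ _) szr.
  - by rewrite hornerD hornerZ one1 r1 mulr0 addr0.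
  move=> j lt_jk; rewrite mulrDr -scalerAr !linearD !linearZ /=.
  case: j lt_jk => [|j] lt_jk; first by rewrite addn0 mulfVK // subrr.
  by rewrite Lr // mulr0 addr0 -addSnnS L1.
(* Applying [y] at shift [n + k.+1] expresses [t] by scalar quantities. *)
have Dt : e - e1 = t * (e2 - e1).
  rewrite -Lr_const /e -(shanks_poly_eps (leqnn _) solp def) Dp.
  rewrite !linearD !linearZ /= -[in L _ p1]addSnnS (shanks_poly_eps _ solp1) //.
  by rewrite addrAC subrr add0r.
by rewrite Dt mulfK // Dp linearD linearZ /= momr addSnnS -!addSnnS.
Qed.

End ShanksPolynomials.

(** * The four equivalent relations *)

Theorem mainTheorem2 (R : realType) (s : scalars)
    (E : lmodType (scalar_field R s)) (S : nat -> E) (y : {scalar E}) :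
  let epst k n := shanks2 y S k n in
  let e (k : int) (n : nat) := eps (fun m => y (S m)) k n in
  (forall n : nat, epst 0%N n = S n) /\
  (forall k n : nat,
     shanks_solvable y S k.+1 n ->
     shanks_solvable y S k n.+1 ->
     shanks_solvable y S k n.+2 ->
     eps_defined (fun m => y (S m)) (2 * k%:Z + 2) n ->
     [/\ epst k.+1 n = epst k n.+1 +
           ((e (2 * k%:Z) n.+2 - e (2 * k%:Z) n.+1) *
            (e (2 * k%:Z + 1) n.+1 - e (2 * k%:Z + 1) n))^-1
           *: (epst k n.+2 - epst k n.+1),
         epst k.+1 n = epst k n.+1 +
           ((e (2 * k%:Z + 1) n.+1 - e (2 * k%:Z - 1) n.+2) /
            (e (2 * k%:Z + 1) n.+1 - e (2 * k%:Z + 1) n))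
           *: (epst k n.+2 - epst k n.+1),
         epst k.+1 n = epst k n.+1 +
           ((e (2 * k%:Z + 2) n - e (2 * k%:Z) n.+1) /
            (e (2 * k%:Z) n.+2 - e (2 * k%:Z) n.+1))
           *: (epst k n.+2 - epst k n.+1)
       & epst k.+1 n = epst k n.+1 +
           ((e (2 * k%:Z + 1) n.+1 - e (2 * k%:Z - 1) n.+2) *
            (e (2 * k%:Z + 2) n - e (2 * k%:Z) n.+1))
           *: (epst k n.+2 - epst k n.+1)]).
Proof.
move=> epst e; split=> [n|k n solv solv1 solv2]; first exact: shanks2_0.
set s0 := fun m => y (S m) in e *.
have -> : 2 * k%:Z + 2 = k.+1.*2 by lia.
have -> : 2 * k%:Z + 1 = k.*2.+1 by lia.
have -> : 2 * k%:Z = k.*2 by lia.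
(* For [k = 0] both sides are the zero column of index $-1$. *)
have Em1 m : e (k.*2%:Z - 1) m = eps_shift s0 k.*2 m.
  by rewrite /e; case: (k.*2) => // i; have -> : i.+1%:Z - 1 = i by lia.
rewrite Em1 /e /eps /eps_defined => def; move: (def).
rewrite doubleS => -[def_e1 [_ def_e2 _ de] _ dw].
have rec := shanks2_rec solv solv1 solv2 def def_e1 def_e2 de.
(* The scalar rule turns the numerators into reciprocals of differences, so all four coefficients
   reduce to that of the first relation. *)
have odd_diff : eps_shift s0 k.*2.+2 n.+1 - eps_shift s0 k.*2 n.+2 =
    (eps_shift s0 k.*2.+1 n.+2 - eps_shift s0 k.*2.+1 n.+1)^-1.
  by rewrite /= addrAC subrr add0r.
have even_diff : eps_shift s0 k.*2.+3 n - eps_shift s0 k.*2.+1 n.+1 =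
    (eps_shift s0 k.*2.+2 n.+1 - eps_shift s0 k.*2.+2 n)^-1.
  by rewrite [eps_shift s0 _.+3 n]/= addrAC subrr add0r.
move: rec; rewrite -/s0 doubleS odd_diff even_diff -!invfM => rec.
by split; rewrite /epst rec // mulrC.
Qed.
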